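(* For integers $r\ge 3$ and $2\le n\le r-1$, we have $nK_r\notin\mathscr{H}$.
   Context: $nK_r$ denotes the disjoint union of $n$ copies of $K_r$; $P_5$ is the path on $5$ vertices. An edge-colored graph is rainbow if all its edges have distinct colors and monochromatic if all its edges have the same color. $R_3(H)$ is the minimum $n$ such that every coloring of the edges of $K_n$ with at most $3$ colors contains a monochromatic copy of $H$. The Gallai-Ramsey number $gr_k(G:H)$ is the minimum integer $N$ such that every coloring of the edges of $K_N$ using at most $k$ colors contains either a rainbow copy of $G$ or a monochromatic copy of $H$. $\mathscr{H}$ denotes the set of graphs $H$ with no isolated vertices for which $gr_k(P_5:H)>R_3(H)$ for some positive integer $k$. *)

(* Defs.v *)
From HB Require Import structures.
From mathcomp Require Import all_boot.

Set Implicit Arguments.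
Unset Strict Implicit.
Unset Printing Implicit Defensive.

Record sgraph := SGraph {
  vertex :> finType;
  adj : rel vertex;
  adj_sym : symmetric adj;
  adj_irr : irreflexive adj
}.

Definition edges (G : sgraph) : {set {set G}} :=
  [set e : {set G} | [exists x, exists y, adj x y && (e == [set x; y])]].

Definition no_isolated (G : sgraph) : Prop := forall x : G, exists y : G, adj x y.

(* The path on m vertices (and m - 1 edges). *)
Section Path.
Variable m : nat.
Definition path_adj : rel 'I_m := fun i j => (i.+1 == j :> nat) || (j.+1 == i :> nat).
Fact path_sym : symmetric path_adj.
Proof. by move=> i j; rewrite /path_adj orbC. Qed.
Fact path_irr : irreflexive path_adj.
Proof. by move=> i; rewrite /path_adj orbb; apply: negbTE; rewrite neq_ltn ltnSn orbT. Qed.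
Definition path_graph : sgraph := SGraph path_sym path_irr.
End Path.

(* n K_r: the vertex (i, a) is the vertex a of the i-th copy of K_r. *)
Section CopiesOfComplete.
Variables n r : nat.
Definition nK_adj : rel ('I_n * 'I_r) := fun u v => (u.1 == v.1) && (u.2 != v.2).
Fact nK_sym : symmetric nK_adj.
Proof. by move=> u v; rewrite /nK_adj eq_sym [u.2 == _]eq_sym. Qed.
Fact nK_irr : irreflexive nK_adj.
Proof. by move=> u; rewrite /nK_adj !eqxx. Qed.
Definition nK : sgraph := SGraph nK_sym nK_irr.
End CopiesOfComplete.

(* Edge-colorings of K_N with at most k colors; only the values on the
   two-element subsets of 'I_N are ever used. *)
Definition coloring (N k : nat) := {ffun {set 'I_N} -> 'I_k}.

(* A copy of G in K_N is given by an injection of the vertices of G into 'I_N;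
   it is not required to be induced, and f @: e is the image of the edge e. *)
Definition has_rainbow N k (c : coloring N k) (G : sgraph) : bool :=
  [exists f : {ffun G -> 'I_N}, injectiveb f &&
    [forall e in edges G, forall e' in edges G,
       (e != e') ==> (c (f @: e) != c (f @: e'))]].

Definition has_mono N k (c : coloring N k) (H : sgraph) : bool :=
  [exists f : {ffun H -> 'I_N}, injectiveb f &&
    [forall e in edges H, forall e' in edges H, c (f @: e) == c (f @: e')]].

(* Ramsey's theorem, needed for the minima below to be over nonempty sets. *)
Lemma ramsey_clique (k s : nat) : exists N : nat,
  forall (T : finType) (c : {set T} -> 'I_k) (q : 'I_k -> nat) (A : {set T}),
    \sum_i q i <= s -> N <= #|A| ->
  exists i : 'I_k, exists S : {set T},
    [/\ S \subset A, #|S| = q i &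
        {in S &, forall x y, x != y -> c [set x; y] = i}].
Proof.
have triv (T : finType) (c : {set T} -> 'I_k) (q : 'I_k -> nat) (A : {set T}) i :
    q i = 0 -> exists i, exists S : {set T}, [/\ S \subset A, #|S| = q i &
        {in S &, forall x y, x != y -> c [set x; y] = i}].
  by move=> qi; exists i, set0; split;
    [exact: sub0set | rewrite cards0 | move=> x y; rewrite inE].
elim: s => [|s [N IH]].
  exists 0 => T c q A; rewrite leqn0 sum_nat_eq0 => /forallP q0 _.
  by apply: (triv _ _ _ _ (c set0)); apply/eqP; exact: (q0 (c set0)).
exists (k * N).+2 => T c q A qs cA.
have [/existsP[i /eqP qi]|] := boolP [exists i, q i == 0]; first exact: triv qi.
rewrite negb_exists => /forallP q0.
have /card_gt0P[x xA] : 0 < #|A| by apply: leq_trans cA.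
pose B i := [set y in A :\ x | c [set x; y] == i].
have [i Bi] : exists i, N <= #|B i|.
  apply/existsP; apply: contraLR cA; rewrite negb_exists => /forallP small.
  rewrite -ltnNge (cardsD1 x A) xA add1n !ltnS.
  have -> : #|A :\ x| = \sum_(i : 'I_k) #|B i|.
    rewrite -sum1_card (partition_big (fun y => c [set x; y]) predT) //=.
    apply: eq_bigr => i _; rewrite -sum1_card; apply: eq_bigl => y.
    by rewrite [in RHS]inE.
  have -> : k * N = \sum_(i < k) N by rewrite sum_nat_const card_ord.
  by apply: leq_sum => i _; apply: ltnW; rewrite ltnNge.
pose q' j := if j == i then (q i).-1 else q j.
have q's : \sum_j q' j <= s.
  move: qs; rewrite (bigD1 i) // [in X in _ -> X](bigD1 i) //= {1}/q' eqxx.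
  rewrite [X in _ -> _ + X <= _](eq_bigr q) => [|j /negbTE ji]; last by rewrite /q' ji.
  by have := q0 i; case: (q i) => // m _; rewrite addSn.
have [j [S [SB cS monoS]]] := IH T c q' (B i) q's Bi.
have SA : S \subset A.
  by apply: subset_trans SB _; apply/subsetP => y; rewrite !inE => /andP[/andP[]].
have [ji|ji] := eqVneq j i; last first.
  by exists j, S; split=> //; rewrite cS /q' (negbTE ji).
have xS : x \notin S.
  by apply/negP => /(subsetP SB); rewrite !inE eqxx.
subst j; exists i, (x |: S); split.
- by rewrite subUset sub1set xA.
- by rewrite cardsU1 xS cS /q' eqxx add1n prednK // lt0n.
have xSi y : y \in S -> c [set x; y] = i.
  by move=> /(subsetP SB); rewrite inE => /andP[_ /eqP].
move=> y z; rewrite !inE => /orP[/eqP->|yS] /orP[/eqP->|zS] yz.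
- by rewrite eqxx in yz.
- exact: xSi.
- by rewrite setUC xSi.
- exact: monoS.
Qed.

Fact ramsey_ex (k : nat) (H : sgraph) :
  exists N, [forall c : coloring N k, has_mono c H].
Proof.
have [N HN] := ramsey_clique k (k * #|H|).
exists N; apply/forallP => c.
have [||i [S [_ cS monoS]]] := HN _ c (fun=> #|H|) setT.
- by rewrite sum_nat_const card_ord.
- by rewrite cardsT card_ord.
pose f (v : H) := enum_val (cast_ord (esym cS) (enum_rank v)).
have fS v : f v \in S by exact: enum_valP.
have f_inj : injective f by move=> u v /enum_val_inj/cast_ord_inj/enum_rank_inj.
have fi e : e \in edges H -> c ([ffun v => f v] @: e) = i.
  rewrite inE => /existsP[x /existsP[y /andP[xy /eqP->]]].
  rewrite imsetU1 imset_set1 !ffunE; apply: monoS => //.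
  by rewrite (inj_eq f_inj); apply: contraTneq xy => ->; rewrite adj_irr.
apply/existsP; exists [ffun v => f v]; apply/andP; split.
  by apply/injectiveP => u v; rewrite !ffunE; exact: f_inj.
by apply/forall_inP => e eH; apply/forall_inP => e' eH'; rewrite !fi.
Qed.

Fact gallai_ramsey_ex (k : nat) (G H : sgraph) :
  exists N, [forall c : coloring N k, has_rainbow c G || has_mono c H].
Proof.
have [N /forallP HN] := ramsey_ex k H.
by exists N; apply/forallP => c; rewrite HN orbT.
Qed.

Definition ramsey (k : nat) (H : sgraph) : nat := ex_minn (ramsey_ex k H).

Definition gallai_ramsey (k : nat) (G H : sgraph) : nat :=
  ex_minn (gallai_ramsey_ex k G H).

(* Membership in the class written with a script H. *)
Definition in_scriptH (H : sgraph) : Prop :=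
  no_isolated H /\
  exists k : nat, 0 < k /\ ramsey 3 H < gallai_ramsey k (path_graph 5) H.

(* Main.v *)
(** Let [R = R_3(nK_r)] and suppose that a coloring of [K_R] has neither a rainbow
    [P_5] nor a monochromatic [nK_r].  A coloring without rainbow [P_5] has at most
    three colors (excluded by the choice of [R]), or becomes monochromatic after
    deleting six vertices (then [R - 6 >= nr] gives [nK_r]), or has a dominant color
    [k0]: the vertices split into parts, and an edge of color [j <> k0] lies inside
    the part of [j].  Indeed, if every vertex sees at most two colors, then the color
    sets of the vertices form a star (dominant color) or a triangle (three colors);
    and a vertex with three colors together with an edge of a fourth color spans at
    most six vertices, which determine the color of all edges disjoint from them by
    a finite search over colorings of eight vertices.

    In the dominant case let [t] be the number of colors [j <> k0] that contain a
    [K_r].  If [t >= r], picking one vertex per part gives [nK_r] in color [k0].  If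
    [t = r - 1], at most [n - 1] disjoint single vertices or [k0]-edges can be
    extended in this way, so all but [2(n - 1)] vertices lie in [r - 1] monochromatic
    parts of at most [nr - 1] vertices.  If [t <= r - 2], deleting at most
    [(t + 1)(n - 1)r] vertices leaves a set [A] with no [K_r] in color [k0] and none
    in the union of the other colors.  Blowing up a 2-coloring of [A] without
    monochromatic [K_r] yields [R > (r - 1)|A| + (n - 1)r + (n - 1)], and likewise
    [R > (r - 1)^3 + (n - 1)r + (n - 1)].  For [n <= r - 1] these bounds contradict
    each other. *)

Require Import Defs.
From mathcomp Require Import all_boot zify.

Set Implicit Arguments.
Unset Strict Implicit.
Unset Printing Implicit Defensive.

(** * Colorings without a rainbow path on five vertices *)

Definition path_colors (V K : Type) (col : V -> V -> K) (q : seq V) : seq K :=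
  if q is x :: q' then pairmap col x q' else [::].

Definition no_rainbow_P5 (V K : eqType) (col : V -> V -> K) :=
  forall q : seq V, size q = 5 -> uniq q -> ~~ uniq (path_colors col q).

(* A partial coloring lists triples (x, y, a) for edges xy of color a. *)
Definition pcoloring := seq (nat * nat * nat).

(* [has] and [all] would evaluate both sides of their boolean operators under
   call by value. *)
Fixpoint lazy_has T (f : T -> bool) s :=
  if s is x :: s' then if f x then true else lazy_has f s' else false.

Fixpoint lazy_all T (f : T -> bool) s :=
  if s is x :: s' then if f x then lazy_all f s' else false else true.

Fixpoint memn (x : nat) s :=
  if s is y :: s' then if eqn x y then true else memn x s' else false.

(* Can the rainbow path [q] with colors [cs] be extended by [k] edges of [st], at
   either end, to a rainbow path?  Both are reversed to extend the far end. *)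
Fixpoint grow (k : nat) (st : pcoloring) (q cs : seq nat) : bool :=
  if k is k'.+1 then
    let step x y a :=
      if memn y q then false else if memn a cs then false else
      if eqn x (head 0 q) then grow k' st (y :: q) (a :: cs) else
      if eqn x (last 0 q) then grow k' st (y :: rev q) (a :: rev cs) else false in
    lazy_has (fun e => if step e.1.1 e.1.2 e.2 then true else step e.1.2 e.1.1 e.2) st
  else true.

(** A rainbow path is detected when its last edge is listed, so only paths through the newest edge
    are tried. *)
Definition rainbow_head (st : pcoloring) : bool :=
  if st is (x, y, a) :: _ then grow 3 st [:: x; y] [:: a] else false.

(* Only the colors [0 .. u - 1] occur in [st], and any new color may be named [u];
   branches with a rainbow [P_5] are pruned. *)
Fixpoint search (es : seq (nat * nat)) (leaf : pcoloring -> nat -> bool)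
    (st : pcoloring) (u : nat) : bool :=
  if es is (x, y) :: es' then
    lazy_all (fun a => let st' := (x, y, a) :: st in
      if rainbow_head st' then true else search es' leaf st' (maxn u a.+1)) (iota 0 u.+1)
  else leaf st u.

Arguments search : simpl never.

Definition edges_below m := [seq (x, y) | y <- iota 0 m, x <- iota 0 y].

Definition majority (st : pcoloring) u :=
  let mult a := count (fun e => eqn a e.2) st in
  foldl (fun b a => if mult b < mult a then a else b) 0 (iota 0 u).

(* No color but the majority color of [st] extends to the edge joining two new
   vertices 6 and 7: the candidate is only guessed, and the search validates it. *)
Definition forced (st : pcoloring) (u : nat) : bool :=
  let k := majority st u in
  lazy_all (fun a => if eqn a k then a < u else
      search ([seq (x, 6) | x <- iota 0 6] ++ [seq (x, 7) | x <- iota 0 6])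
        (fun _ _ => false) ((6, 7, a) :: st) (maxn u a.+1)) (iota 0 u.+1).

Definition check (seed : pcoloring) :=
  search [seq e <- edges_below 6 | e \notin unzip1 seed] forced seed 4.

(* A vertex 0 with three colors and an edge of a fourth color: up to the choice of
   the three neighbors of 0, the edge meets 0, or joins two of the neighbors, or
   joins a neighbor to another vertex of the same color at 0. *)
Definition seed_star : pcoloring := [:: (0, 4, 3); (0, 3, 2); (0, 2, 1); (0, 1, 0)].
Definition seed_triangle : pcoloring := [:: (1, 2, 3); (0, 3, 2); (0, 2, 1); (0, 1, 0)].
Definition seed_pendant : pcoloring :=
  [:: (1, 4, 3); (0, 4, 0); (0, 3, 2); (0, 2, 1); (0, 1, 0)].

Arguments forced : simpl never.

Lemma check_star : check seed_star.
Proof. by vm_compute. Qed.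

Lemma check_triangle : check seed_triangle.
Proof. by vm_compute. Qed.

Lemma check_pendant : check seed_pendant.
Proof. by vm_compute. Qed.

Lemma lazy_hasE T (f : T -> bool) s : lazy_has f s = has f s.
Proof. by elim: s => //= x s ->; case: (f x). Qed.

Lemma lazy_allE T (f : T -> bool) s : lazy_all f s = all f s.
Proof. by elim: s => //= x s ->; case: (f x). Qed.

Lemma search_cons x y es leaf st u :
  search ((x, y) :: es) leaf st u =
    all (fun a => if rainbow_head ((x, y, a) :: st) then true
                  else search es leaf ((x, y, a) :: st) (maxn u a.+1)) (iota 0 u.+1).
Proof. exact: lazy_allE. Qed.

Lemma memnE x s : memn x s = (x \in s).
Proof. by elim: s => //= y s ->; rewrite inE -eqnE; case: eqn. Qed.

(** * Soundness of the finite search *)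

Section Soundness.
Variables (V K : eqType) (col : V -> V -> K) (v0 : V) (c0 : K).
Hypothesis col_sym : forall x y, col x y = col y x.
Hypothesis no_rainbow : no_rainbow_P5 col.

Lemma path_colors_rev q : path_colors col (rev q) = rev (path_colors col q).
Proof.
have rconsE x y q' : path_colors col (rcons (rcons q' x) y) =
    rcons (path_colors col (rcons q' x)) (col x y).
  by case: q' => //= z q'; rewrite -!cats1 -!catA !pairmap_cat -catA.
case: q => // x q; elim: q x => // y q IH x.
by rewrite rev_cons rev_cons rconsE -rev_cons IH /= rev_cons col_sym.
Qed.

Implicit Types (vs : seq V) (cs : seq K) (st : pcoloring).

Definition realizes vs cs st :=
  forall e, e \in st -> [/\ e.1.1 < size vs, e.1.2 < size vs, e.2 < size cs &
    col (nth v0 vs e.1.1) (nth v0 vs e.1.2) = nth c0 cs e.2].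

Lemma realizes_cat vs cs st vs' : realizes vs cs st -> realizes (vs ++ vs') cs st.
Proof.
move=> real e /real[xv yv ac cxy]; rewrite size_cat !nth_cat xv yv.
by split=> //; apply: ltn_addr.
Qed.

(** Invariant: [q] and [ds] index the vertices and colors of a path that is rainbow in [col].
    Reaching [k = 0] would yield a rainbow [P_5]. *)
Lemma growP vs cs k st q ds :
  uniq vs -> uniq cs -> realizes vs cs st ->
  size q + k = 5 -> 0 < size q -> all (gtn (size vs)) q -> all (gtn (size cs)) ds ->
  uniq q -> uniq ds ->
  path_colors col (map (nth v0 vs) q) = map (nth c0 cs) ds ->
  grow k st q ds = false.
Proof.
move=> Uvs Ucs real; elim: k q ds => [|k IH] q ds sz q0 qb db Uq Ud colq.
  have := no_rainbow (_ : size (map (nth v0 vs) q) = 5).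
  rewrite size_map -sz addn0 => /(_ erefl); rewrite map_inj_in_uniq; last first.
    move=> x y /(allP qb)/= xb /(allP qb)/= yb /eqP.
    by rewrite nth_uniq // => /eqP.
  rewrite colq map_inj_in_uniq ?Ud; first by move=> /(_ Uq).
  move=> x y /(allP db)/= xb /(allP db)/= yb /eqP.
  by rewrite nth_uniq // => /eqP.
rewrite /= lazy_hasE; apply/negbTE/hasPn => -[[x y] a] /= est.
have [/= xv yv ac cxy] := real _ est.
have ext x' y' : x' < size vs -> y' < size vs ->
    col (nth v0 vs x') (nth v0 vs y') = nth c0 cs a ->
    (if memn y' q then false else if memn a ds then false else
     if eqn x' (head 0 q) then grow k st (y' :: q) (a :: ds) else
     if eqn x' (last 0 q) then grow k st (y' :: rev q) (a :: rev ds) else false) = false.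
  move=> xv' yv' cxy'; rewrite !memnE; case: ifP => // yq; case: ifP => // ads.
  rewrite !eqnE; case: eqP => [xq|_].
    apply: IH; rewrite /= ?yq ?ads ?qb ?db ?ac ?yv' -?sz ?addSnnS //.
    by case: q q0 colq xq {sz qb Uq yq} => //= z q _ -> <-; rewrite -cxy' col_sym.
  case: eqP => // xq.
  apply: IH; rewrite /= ?mem_rev ?rev_uniq ?yq ?ads ?all_rev ?qb ?db ?ac ?yv' ?size_rev
    -?sz ?addSnnS //.
  rewrite map_rev map_rev -colq -path_colors_rev.
  case/lastP: q q0 colq xq {sz qb Uq yq} => // q z _ _; rewrite last_rcons => <-.
  by rewrite map_rcons rev_rcons /= -cxy' col_sym.
by rewrite ext // ext // col_sym.
Qed.

(** The actual color of the edge is either listed in [cs] or appended to it, so it is among the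
    [size cs + 1] values that the search tries. *)
Lemma add_edge vs cs st x y :
  uniq vs -> uniq cs -> realizes vs cs st -> x < size vs -> y < size vs ->
  exists cs' a,
    [/\ a <= size cs, uniq cs', realizes vs cs' ((x, y, a) :: st),
        size cs' = maxn (size cs) a.+1 & a < size cs -> cs' = cs].
Proof.
move=> Uvs Ucs real xv yv; set c := col (nth v0 vs x) (nth v0 vs y).
have [ccs|ccs] := boolP (c \in cs).
  have ic : index c cs < size cs by rewrite index_mem.
  exists cs, (index c cs); split=> //; first exact: ltnW.
    by move=> e; rewrite inE => /orP[/eqP->|/real//]; split; rewrite //= nth_index.
  by apply/esym/maxn_idPl.
exists (rcons cs c), (size cs); split=> //.
- by rewrite rcons_uniq ccs.
- move=> e; rewrite inE size_rcons => /orP[/eqP->|/real[ev ev' ec cE]].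
    by split; rewrite //= nth_rcons ltnn eqxx.
  by split; rewrite ?(leq_trans ec) // nth_rcons ec.
- by rewrite size_rcons; apply/esym/maxn_idPr.
- by rewrite ltnn.
Qed.

(** The branch that follows the actual coloring is never pruned, by [growP], and so it reaches a
    leaf. *)
Lemma searchP es leaf vs cs st :
  uniq vs -> uniq cs -> realizes vs cs st ->
  all (fun e => [&& e.1 < size vs, e.2 < size vs & e.1 != e.2]) es ->
  search es leaf st (size cs) ->
  exists cs' st', [/\ uniq cs', realizes vs cs' st' & leaf st' (size cs')].
Proof.
move=> Uvs; elim: es cs st => [|[x y] es IH] cs st Ucs real.
  by move=> _ lf; exists cs, st.
move=> /andP[/and3P[xv yv xy] esv] /[!search_cons] /allP srch.
have [cs' [a [acs' Ucs' real' szcs' _]]] :=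
  add_edge Uvs Ucs real xv yv.
have := srch a.
rewrite mem_iota add0n ltnS -szcs' => /(_ acs'); rewrite ifF; first exact: IH.
have [_ _ aub cxy] := real' _ (mem_head _ _).
apply: (@growP vs cs' 3 _ [:: x; y] [:: a]) Uvs Ucs' real' _ _ _ _ _ _ _;
  rewrite /= ?xv ?yv ?(aub : a < size cs') ?inE ?andbT //.
by rewrite cxy.
Qed.

Lemma forcedP vs cs st :
  size vs = 6 -> uniq vs -> uniq cs -> realizes vs cs st -> forced st (size cs) ->
  forall w w', w \notin vs -> w' \notin vs -> w != w' ->
    col w w' = nth c0 cs (majority st (size cs)).
Proof.
move=> sz Uvs Ucs real + w w' wv wv' ww'.
pose vs' := vs ++ [:: w; w'].
have sz' : size vs' = 8 by rewrite size_cat sz.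
have Uvs' : uniq vs'.
  by rewrite cat_uniq Uvs /= orbF negb_or wv wv' inE ww'.
have [cs' [a [acs' Ucs' real' szcs' cs'E]]] :
  exists cs' a, [/\ a <= size cs, uniq cs', realizes vs' cs' ((6, 7, a) :: st),
    size cs' = maxn (size cs) a.+1 & a < size cs -> cs' = cs].
  by apply: add_edge; rewrite ?sz' //; exact: realizes_cat.
have [/= _ _ _] := real' _ (mem_head _ _).
rewrite !nth_cat sz /= => ->.
rewrite /forced lazy_allE => /allP srch; have := srch a; clear srch.
rewrite mem_iota add0n ltnS -szcs' eqnE => /(_ acs').
(* The test [a < u] says that no color was appended, so [nth] reads the same entry in [cs'] and
   [cs]. For any other [a], the search would have to reach a leaf that is constantly false. *)
case: eqP => [<- lt_a|_]; first by rewrite cs'E.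
case/(searchP Uvs' Ucs' real') => [|? [? []] //].
by rewrite sz'.
Qed.

Lemma checkP vs cs seed :
  size vs = 6 -> uniq vs -> size cs = 4 -> uniq cs -> realizes vs cs seed -> check seed ->
  exists k, forall w w', w \notin vs -> w' \notin vs -> w != w' -> col w w' = k.
Proof.
move=> szv Uvs szc Ucs real.
have := @searchP _ forced vs cs seed Uvs Ucs real; rewrite szc szv => sound /sound[].
  have bounds : all (fun e : nat * nat => [&& e.1 < 6, e.2 < 6 & e.1 != e.2]) (edges_below 6).
    by [].
  by apply/allP => e; rewrite mem_filter => /andP[_]; exact: (allP bounds).
move=> cs' [st' [Ucs' real' fo]].
by exists (nth c0 cs' (majority st' (size cs'))); exact: forcedP fo.
Qed.

End Soundness.

(** * Structure of colorings without a rainbow [P_5] *)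

Section Structure.
Variables (V : finType) (K : eqType) (col : V -> V -> K).
Hypothesis col_sym : forall x y, col x y = col y x.
Hypothesis no_rainbow : no_rainbow_P5 col.
Hypothesis V6 : 6 <= #|V|.

Definition almost_mono :=
  exists (Q : {set V}) (k : K), #|Q| <= 6 /\
    forall x y, x \notin Q -> y \notin Q -> x != y -> col x y = k.

(** The vertices of the seed are padded with arbitrary ones to a six-element set, which serves as
    [Q]. *)
Lemma seed_almost_mono v0 c0 vs cs seed :
  size vs <= 6 -> uniq vs -> size cs = 4 -> uniq cs ->
  realizes col v0 c0 vs cs seed -> check seed -> almost_mono.
Proof.
move=> szv Uvs szc Ucs real chk.
pose t := take (6 - size vs) (enum [predC vs]).
have szt : size t = 6 - size vs.
  rewrite size_take_min -cardE; apply/minn_idPl.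
  by rewrite leq_subLR -[X in X + _](card_uniqP Uvs) (cardC (mem vs)).
have Ut : uniq (vs ++ t).
  rewrite cat_uniq Uvs take_uniq ?enum_uniq // andbT; apply/hasPn => x /mem_take.
  by rewrite mem_enum.
have sz6 : size (vs ++ t) = 6 by rewrite size_cat szt subnKC.
have [k colk] := checkP col_sym no_rainbow sz6 Ut szc Ucs (realizes_cat t real) chk.
exists [set x in vs ++ t], k; split=> [|x y]; last by rewrite !inE; exact: colk.
by rewrite cardsE -sz6; exact: card_size.
Qed.

Lemma star_almost_mono v z1 z2 z3 z4 :
  v \notin [:: z1; z2; z3; z4] ->
  uniq [:: col v z1; col v z2; col v z3; col v z4] -> almost_mono.
Proof.
move=> vz Uc; apply: (@seed_almost_mono v (col v v) [:: v; z1; z2; z3; z4]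
  [:: col v z1; col v z2; col v z3; col v z4] seed_star _ _ _ Uc _ check_star) => //.
  by rewrite cons_uniq vz (map_uniq (Uc : uniq (map (col v) [:: z1; z2; z3; z4]))).
by move=> e; rewrite !inE => /or4P[]/eqP->.
Qed.

Lemma triangle_almost_mono v x y z :
  v \notin [:: x; y; z] ->
  uniq [:: col v x; col v y; col v z; col x y] -> almost_mono.
Proof.
move=> vz Uc; apply: (@seed_almost_mono v (col v v) [:: v; x; y; z]
  [:: col v x; col v y; col v z; col x y] seed_triangle _ _ _ Uc _ check_triangle) => //.
  rewrite cons_uniq vz; apply: (@map_uniq _ _ (col v)).
  by apply: subseq_uniq Uc; exact: (prefix_subseq _ [:: col x y]).
by move=> e; rewrite !inE => /or4P[]/eqP->.
Qed.

Lemma pendant_almost_mono v x y u z :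
  v \notin [:: x; u; z; y] -> x != y -> col v y = col v x ->
  uniq [:: col v x; col v u; col v z; col x y] -> almost_mono.
Proof.
move=> vz xy cvy Uc.
apply: (@seed_almost_mono v (col v v) [:: v; x; u; z; y]
  [:: col v x; col v u; col v z; col x y] seed_pendant _ _ _ Uc _ check_pendant) => //.
  rewrite cons_uniq vz; have := Uc; rewrite /= !inE !negb_or.
  case/and4P=> /and3P[xu xz _] /andP[uz _] _ _.
  rewrite xy !andbT; apply/and3P; split; [apply/andP; split|apply/andP; split|].
  - by apply: contraNneq xu => ->.
  - by apply: contraNneq xz => ->.
  - by apply: contraNneq uz => ->.
  - by apply: contraNneq xu => ->; rewrite cvy.
  - by apply: contraNneq xz => ->; rewrite cvy.
by move=> e; rewrite !inE => /or4P[|||/orP[]]/eqP-> //; split.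
Qed.

Lemma four_colors_almost_mono v z1 z2 z3 x y :
  v \notin [:: z1; z2; z3] -> x != y ->
  uniq [:: col v z1; col v z2; col v z3; col x y] -> almost_mono.
Proof.
move=> vz xy Uc; have := vz; rewrite !inE !negb_or => /and3P[v1 v2 v3].
have star u : v != u -> col v u \notin [:: col v z1; col v z2; col v z3] -> almost_mono.
  move=> vu cu; apply: (@star_almost_mono v u z1 z2 z3); first by rewrite inE negb_or vu.
  rewrite cons_uniq cu; apply: subseq_uniq Uc; exact: (prefix_subseq _ [:: col x y]).
have cxy : col x y \notin [:: col v z1; col v z2; col v z3].
  by move: Uc; rewrite -[[:: _; _; _; _]]/(rcons [:: _; _; _] _) rcons_uniq => /andP[].
(* A fourth color at [v] is the star seed. Otherwise [v] is not on the edge [xy], and [x] and [y]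
   are joined to [v] in two of the three given colors. *)
have [xv|xv] := eqVneq v x; first by move: xy cxy; rewrite -xv; exact: star.
have [yv|yv] := eqVneq v y; first by move: xy cxy; rewrite -yv eq_sym col_sym; exact: star.
have [cx|] := boolP (col v x \in [:: col v z1; col v z2; col v z3]); last exact: star.
have [cy|] := boolP (col v y \in [:: col v z1; col v z2; col v z3]); last exact: star.
have yx : y != x by rewrite eq_sym.
have pen := pendant_almost_mono (v := v) (x := x) (y := y).
have tri := triangle_almost_mono (v := v) (x := x) (y := y).
move: Uc; rewrite /= !inE !negb_or => /and4P[/and3P[c12 c13 c1] /andP[c23 c2] c3 _].
have c21 := c12; have c31 := c13; have c32 := c23; rewrite eq_sym in c21.
rewrite eq_sym in c31; rewrite eq_sym in c32.
(* Each of [x], [y] can replace the [z] of its color. Equal colors at [v] give the pendant seed with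
   the other two [z]; different ones give the triangle seed with the remaining [z]. *)
move: cx cy; rewrite !inE => /or3P[]/eqP ex /or3P[]/eqP ey;
  [ apply: (pen z2 z3) | apply: (tri z3)    | apply: (tri z2)
  | apply: (tri z3)    | apply: (pen z1 z3) | apply: (tri z1)
  | apply: (tri z2)    | apply: (tri z1)    | apply: (pen z1 z2)];
  by rewrite ?ex ?ey /= ?inE ?negb_or ?xv ?yv ?v1 ?v2 ?v3
    ?c12 ?c13 ?c23 ?c21 ?c31 ?c32 ?c1 ?c2 ?c3.
Qed.

Lemma no_rainbow_structure :
  [\/ exists2 l : seq K, size l <= 3 & forall x y, x != y -> col x y \in l,
      exists (k0 : K) (p : V -> K), forall x y, x != y -> col x y != k0 ->
        p x = col x y /\ p y = col x y |
      almost_mono].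
Proof.
have [|] := boolP [exists v, exists z1, exists z2, exists z3,
    (v \notin [:: z1; z2; z3]) && uniq [:: col v z1; col v z2; col v z3]].
  case/existsP=> v /existsP[z1 /existsP[z2 /existsP[z3 /andP[vz Uc]]]].
  pose l := [:: col v z1; col v z2; col v z3].
  have [/existsP[x /existsP[y /andP[xy cxy]]]|] :=
    boolP [exists x, exists y, (x != y) && (col x y \notin l)].
    apply: Or33; apply: (four_colors_almost_mono vz xy).
    by rewrite -[[:: _; _; _; _]]/(rcons l _) rcons_uniq cxy.
  rewrite negb_exists => /forallP all_l; apply: Or31; exists l => // x y xy.
  by have := all_l x; rewrite negb_exists => /forallP/(_ y); rewrite xy /= negbK.
rewrite negb_exists => /forallP loc.
pose sees v a := [exists y, (v != y) && (col v y == a)].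
have seesc x y : x != y -> sees x (col x y) by move=> xy; apply/existsP; exists y; rewrite xy /=.
have seesc' x y : x != y -> sees y (col x y) by rewrite eq_sym col_sym; exact: seesc.
have two v a b c : sees v a -> sees v b -> a != b -> sees v c -> c \in [:: a; b].
  case/existsP=> x /andP[vx /eqP<-] /existsP[y /andP[vy /eqP<-]] ab.
  case/existsP=> z /andP[vz /eqP<-]; apply/negPn/negP => cz.
  have := loc v; rewrite negb_exists => /forallP/(_ z); rewrite negb_exists => /forallP/(_ x).
  rewrite negb_exists => /forallP/(_ y); rewrite cons_uniq cz /= !inE !negb_or.
  by rewrite vx vy vz ab.
(* Since every vertex sees at most two colors, the color sets form a star, whose
   center is dominant, or a triangle. *)
have dominant a : (forall x, sees x a) ->
    exists (k0 : K) (p : V -> K), forall x y, x != y -> col x y != k0 ->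
        p x = col x y /\ p y = col x y.
  move=> alla.
  (* [p x] is the color other than [a] seen by [x], if there is one; by [two] it is unique. *)
  pose p x := if [pick y | (x != y) && (col x y != a)] is Some y then col x y else a.
  have px x y : x != y -> col x y != a -> p x = col x y.
    move=> xy cxy; rewrite /p; case: pickP => [z /andP[xz cz]|/(_ y)]; last by rewrite xy cxy.
    have := two x a (col x z) (col x y) (alla x) (seesc _ _ xz).
    by rewrite eq_sym cz => /(_ isT (seesc _ _ xy)); rewrite !inE (negbTE cxy) => /eqP->.
  exists a, p => x y xy cxy; split; first exact: px.
  by rewrite col_sym; apply: px; [rewrite eq_sym|rewrite col_sym].
have [x0 [x1 [_ _ x01]]] : exists x0 x1, [/\ x0 \in [set: V], x1 \in [set: V] & x0 != x1].
  by apply/card_gt1P; rewrite cardsT; lia.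
pose a := col x0 x1; have x0a : sees x0 a by exact: seesc.
have [/forallP alla|] := boolP [forall x, sees x a].
  by apply: Or32; exact: dominant alla.
(* With neither [a] nor [b] seen everywhere, a vertex [w1] missing [a] and a vertex [w2] missing [b]
   form with [x0] a triangle of colors [a], [b], [d]. *)
rewrite negb_forall => /existsP[w1 w1a].
have xw1 : x0 != w1 by apply: contraNneq w1a => <-.
pose b := col x0 w1; have x0b : sees x0 b by exact: seesc.
have w1b : sees w1 b by exact: seesc'.
have ab : a != b by apply: contraNneq w1a => ->.
have [/forallP allb|] := boolP [forall x, sees x b].
  by apply: Or32; exact: dominant allb.
rewrite negb_forall => /existsP[w2 w2b].
have xw2 : x0 != w2 by apply: contraNneq w2b => <-.
have w2a : sees w2 a.
  have := two x0 a b _ x0a x0b ab (seesc _ _ xw2); rewrite !inE => /orP[]/eqP cE.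
    by rewrite -cE; exact: seesc'.
  by case/negP: w2b; rewrite -cE; exact: seesc'.
have w12 : w1 != w2 by apply: contraNneq w1a => ->.
pose d := col w1 w2; have w1d : sees w1 d by exact: seesc.
have w2d : sees w2 d by exact: seesc'.
have ad : a != d by apply: contraNneq w1a => ->.
have bd : b != d by apply: contraNneq w2b => ->.
have see2 u : exists c c', [/\ sees u c, sees u c', c != c' & {subset [:: c; c'] <= [:: a; b; d]}].
  have [->|u0] := eqVneq u x0.
    by exists a, b; split=> // c; rewrite !inE => /orP[]->; rewrite ?orbT.
  have [->|u1] := eqVneq u w1.
    by exists b, d; split=> // c; rewrite !inE => /orP[]->; rewrite ?orbT.
  have [->|u2] := eqVneq u w2.
    by exists a, d; split=> // c; rewrite !inE => /orP[]->; rewrite ?orbT.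
  (* The edges from [u] to [x0], [w1], [w2] have colors in [{a, b}], [{b, d}], [{a, d}]. No color
     lies in all three sets, so [u] sees two of them. *)
  have c0 := two _ _ _ _ x0a x0b ab (seesc' _ _ u0).
  have c1 := two _ _ _ _ w1b w1d bd (seesc' _ _ u1).
  have c2 := two _ _ _ _ w2a w2d ad (seesc' _ _ u2).
  have [cE|cN] := eqVneq (col u x0) a.
    exists (col u x0), (col u w1); split; try exact: seesc.
      by move: c1; rewrite !inE cE => /orP[]/eqP->.
    move=> c; rewrite !inE => /orP[]/eqP->; first by rewrite cE eqxx.
    by move: c1; rewrite !inE => /orP[]->; rewrite ?orbT.
  have {cN}cE : col u x0 = b by move: c0; rewrite !inE (negbTE cN) => /eqP.
  exists (col u x0), (col u w2); split; try exact: seesc.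
    by move: c2; rewrite !inE cE => /orP[]/eqP->; rewrite // eq_sym.
  move=> c; rewrite !inE => /orP[]/eqP->; first by rewrite cE eqxx orbT.
  by move: c2; rewrite !inE => /orP[]->; rewrite ?orbT.
apply: Or31; exists [:: a; b; d] => // x y xy.
have [c [c' [xc xc' cc' sub]]] := see2 x.
by apply: sub; apply: two xc xc' cc' _; exact: seesc.
Qed.

End Structure.

(** * Packings of cliques *)

Definition packing (V : finType) n (P : pred {set V}) :=
  exists F : 'I_n -> {set V},
    (forall i, P (F i)) /\ (forall i j, i != j -> [disjoint F i & F j]).

Lemma leq_card_bigcup (V I : finType) (A : {pred I}) (F : I -> {set V}) s :
  (forall i, i \in A -> #|F i| <= s) -> #|\bigcup_(i in A) F i| <= #|A| * s.
Proof.
move=> Fs; rewrite -sum_nat_const.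
elim/big_rec2: _ => [|i m B iA le_Bm]; first by rewrite cards0.
by apply: leq_trans (leq_card_setU _ _) _; apply: leq_add => //; exact: Fs.
Qed.

(** Greedy choice: when no further disjoint set exists, the union of those chosen, fewer than [n],
    meets every set in [P]. *)
Lemma packing_or_hitting (V : finType) (P : pred {set V}) n s :
  (forall S, P S -> #|S| <= s) ->
  packing n P \/
  exists2 B : {set V}, #|B| <= n.-1 * s & forall S, P S -> ~~ [disjoint S & B].
Proof.
move=> Ps; elim: n => [|n [[F [PF disF]]|[B cB hitB]]].
- by left; exists (fun=> set0); split=> [[]|[]].
- have [/existsP[S /andP[PS disS]]|] :=
    boolP [exists S, P S && [disjoint S & \bigcup_(i in 'I_n) F i]].
    have disSF j : [disjoint S & F j].
      by apply: disjointWr disS; exact: (bigcup_sup j).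
    left; exists (fun i => if unlift ord0 i is Some j then F j else S).
    split=> [i|i j]; first by case: unliftP.
    case: unliftP => [i' ->|->]; case: unliftP => [j' ->|->]; rewrite ?eqxx //.
      by rewrite (inj_eq lift_inj); exact: disF.
    by rewrite disjoint_sym.
  rewrite negb_exists => /forallP hit; right; exists (\bigcup_(i in 'I_n) F i) => [|S PS].
    by rewrite -[n.+1.-1]card_ord; apply: leq_card_bigcup => i _; exact: Ps.
  by have := hit S; rewrite PS.
- right; exists B => //; apply: leq_trans cB _.
  by rewrite leq_mul2r /= leq_pred orbT.
Qed.

Lemma subset_of_card (V : finType) (A : {set V}) m :
  m <= #|A| -> exists2 S : {set V}, S \subset A & #|S| = m.
Proof.
move=> le_mA; have [S] : exists S : {set V}, S \in [set S : {set V} | S \subset A & #|S| == m].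
  by apply/set0Pn; rewrite -card_gt0 cards_draws bin_gt0.
by rewrite inE => /andP[SA /eqP]; exists S.
Qed.

Section Clique.
Variables (V : finType) (K : eqType) (col : V -> V -> K).

Definition clique (a : K) (S : {set V}) :=
  [forall x in S, forall y in S, (x != y) ==> (col x y == a)].

Definition rclique r a (S : {set V}) := (#|S| == r) && clique a S.

Lemma cliqueP a (S : {set V}) :
  reflect {in S &, forall x y, x != y -> col x y = a} (clique a S).
Proof.
apply: (iffP forall_inP) => [cl x y xS yS xy|cl x xS].
  by have /forall_inP/(_ y yS) := cl x xS; rewrite xy => /eqP.
by apply/forall_inP => y yS; apply/implyP => xy; rewrite cl.
Qed.

Lemma cliqueS a (A B : {set V}) : A \subset B -> clique a B -> clique a A.
Proof.
move=> /subsetP AB /cliqueP clB; apply/cliqueP => x y /AB xB /AB yB; exact: clB.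
Qed.

Lemma packing_of_geq n r a (F : 'I_n -> {set V}) :
  (forall i, r <= #|F i|) -> (forall i, clique a (F i)) ->
  (forall i j, i != j -> [disjoint F i & F j]) -> packing n (rclique r a).
Proof.
move=> Fr clF disF.
have /fin_all_exists2[G GF Gr] i := subset_of_card (Fr i).
exists G; split=> [i|i j ij]; first by rewrite /rclique Gr eqxx (cliqueS (GF i)).
exact: disjointWl (GF i) (disjointWr (GF j) (disF _ _ ij)).
Qed.

Lemma rclique_hitting n r a :
  ~ packing n (rclique r a) ->
  exists2 B : {set V}, #|B| <= n.-1 * r &
    forall S : {set V}, rclique r a S -> ~~ [disjoint S & B].
Proof.
by move=> nP; case: (@packing_or_hitting V (rclique r a) n r) => [S /andP[/eqP->]||].
Qed.

(** A hitting set of at most [(n - 1)r] vertices leaves [r] vertices of [S], which form a clique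
    that it misses. *)
Lemma packing_in_clique n r a (S : {set V}) :
  0 < n -> n * r <= #|S| -> clique a S -> packing n (rclique r a).
Proof.
move=> n0 nrS clS; case: (@packing_or_hitting V
  (fun A => rclique r a A && (A \subset S)) n r) => [A /andP[/andP[/eqP->]] //||].
  by case=> F [PF disF]; exists F; split=> // i; case/andP: (PF i).
case=> B cB hitB.
have [|A ASB Ar] := @subset_of_card V (S :\: B) r.
  have := cardsID B S; have := subset_leq_card (subsetIr S B); nia.
have AS : A \subset S by apply: subset_trans ASB (subsetDl _ _).
have := hitB A; rewrite /rclique Ar eqxx (cliqueS AS) // AS => /(_ isT)/negP[].
by move: ASB; rewrite subsetD => /andP[].
Qed.

End Clique.

(** * Completing cliques of the dominant color *)

Section Completion.
Variables (V K : finType) (col : V -> V -> K) (k0 : K) (p : V -> K).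
Hypothesis col_sym : forall x y, col x y = col y x.
Hypothesis dom : forall x y, x != y -> col x y != k0 -> p x = col x y /\ p y = col x y.

Lemma dom_cross x y : p x != p y -> col x y = k0.
Proof.
move=> pxy; apply/eqP; apply: contraNT pxy => ck0.
have [-> //|xy] := eqVneq x y; by have [-> ->] := dom xy ck0.
Qed.

Lemma rclique_part r j S : 1 < r -> j != k0 -> rclique col r j S -> {in S, forall x, p x = j}.
Proof.
move=> r1 jk /andP[/eqP Sr /cliqueP clS] x xS.
have [y] : exists y, y \in S :\ x by apply/card_gt0P; have := cardsD1 x S; rewrite xS Sr; lia.
rewrite !inE eq_sym => /andP[xy yS]; have cxy := clS x y xS yS xy.
by have [|->] := dom xy; rewrite cxy.
Qed.

(* Since [S] is a clique of color [j], it meets each [F i] in at most one point, so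
   its vertices outside the sets [F i] suffice to complete those missing the part of
   [j]. *)
Lemma complete_part n r j S (F : 'I_n -> {set V}) :
  1 < r -> n <= r -> j != k0 -> rclique col r j S ->
  (forall i, clique col k0 (F i)) -> (forall i i', i != i' -> [disjoint F i & F i']) ->
  exists F' : 'I_n -> {set V},
    [/\ forall i, F i \subset F' i, forall i, clique col k0 (F' i),
        forall i i', i != i' -> [disjoint F' i & F' i'] &
        forall i, exists2 x, x \in F' i & p x = j].
Proof.
move=> r1 nr jk rS clF disF.
have pS := rclique_part r1 jk rS; have /andP[/eqP Sr /cliqueP clS] := rS.
(* [I] collects the sets that miss the part of [j], and [A] the vertices of [S] free to be added to
   them. The other [n - |I|] sets use up at most one vertex of [S] each, so
   [|A| >= r - (n - |I|) >= |I|]. *)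
pose I := [set i | [disjoint F i & [set x | p x == j]]].
pose A := S :\: \bigcup_(i in ~: I) F i.
have IP i x : i \in I -> x \in F i -> p x != j.
  by rewrite inE => /disjoint_setI0/setP/(_ x); rewrite !inE => + xF; rewrite xF => /= ->.
have AF i x : x \in A -> x \notin F i.
  rewrite !inE => /andP[xF xS]; apply/negP => xFi.
  have [iI|iI] := boolP (i \in I); first by have := IP i x iI xFi; rewrite pS ?eqxx.
  by case/negP: xF; apply/bigcupP; exists i => //; rewrite inE.
have IA : #|I| <= #|A|.
  have : #|\bigcup_(i in ~: I) (F i :&: S)| <= #|~: I| * 1.
    apply: leq_card_bigcup => i _; rewrite leqNgt; apply/negP => /card_gt1P[x [y [+ + xy]]].
    rewrite !inE => /andP[xF xS] /andP[yF yS].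
    by have /cliqueP := clF i => /(_ x y xF yF xy); rewrite clS // => /eqP; rewrite (negbTE jk).
  rewrite -big_distrl /= setIC muln1.
  have := cardsID (\bigcup_(i in ~: I) F i) S; rewrite -/A Sr.
  have := cardsC I; rewrite card_ord => eI eS le.
  rewrite -(leq_add2r #|~: I|) eI (leq_trans nr) // -eS addnC leq_add2l. exact: le.
have [x0 _] : exists x0, x0 \in S by apply/card_gt0P; lia.
pose phi i := nth x0 (enum A) (index i (enum I)).
have phi_lt i : i \in I -> index i (enum I) < size (enum A).
  by move=> iI; rewrite -cardE; apply: leq_trans IA; rewrite cardE index_mem mem_enum.
have phiA i : i \in I -> phi i \in A.
  by move=> iI; rewrite -mem_enum mem_nth // phi_lt.
have phi_inj : {in I &, injective phi}.
  move=> i i' iI iI' /eqP; rewrite nth_uniq ?enum_uniq ?phi_lt // => /eqP eq_idx.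
  by rewrite -[i](nth_index i (_ : i \in enum I)) ?mem_enum // eq_idx nth_index ?mem_enum.
have pphi i : i \in I -> p (phi i) = j.
  by move=> /phiA; rewrite inE => /andP[_]; exact: pS.
have phiF i i' : i \in I -> phi i \notin F i' by move=> /phiA; exact: AF.
exists (fun i => if i \in I then phi i |: F i else F i); split.
- by move=> i; case: ifP => // _; exact: subsetUr.
- move=> i; case: ifP => // iI; apply/cliqueP => x y.
  have cphi z : z \in F i -> col (phi i) z = k0.
    by move=> zF; apply: dom_cross; rewrite pphi // eq_sym; exact: IP zF.
  rewrite !inE => /orP[/eqP->|xF] /orP[/eqP->|yF]; rewrite ?eqxx //.
  + by move=> _; exact: cphi.
  + by move=> _; rewrite col_sym; exact: cphi.
  + by move: x y xF yF; exact/cliqueP.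
- move=> i i' ii'; rewrite -setI_eq0; apply/eqP/setP => x; rewrite in_setI in_set0.
  have disx : x \in F i -> x \in F i' -> false.
    by move=> xF xF'; have /disjoint_setI0/setP/(_ x) := disF i i' ii'; rewrite !inE xF xF'.
  apply/negP; case: ifP => iI; case: ifP => iI'; rewrite ?in_setU1.
  + case/andP=> /orP[/eqP->|xF] /orP[/eqP|xF'].
    * by move=> /phi_inj-/(_ iI iI') eii; rewrite eii eqxx in ii'.
    * by rewrite (negbTE (phiF _ _ iI)) in xF'.
    * by move=> ex; rewrite ex (negbTE (phiF _ _ iI')) in xF.
    * by move: (disx xF xF').
  + case/andP=> /orP[/eqP->|xF] xF'; last by move: (disx xF xF').
    by rewrite (negbTE (phiF _ _ iI)) in xF'.
  + case/andP=> xF /orP[/eqP ex|xF']; last by move: (disx xF xF').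
    by rewrite ex (negbTE (phiF _ _ iI')) in xF.
  + by case/andP=> xF xF'; move: (disx xF xF').
- move=> i; case: ifP => [iI|/negbT].
    by exists (phi i); rewrite ?setU11 ?pphi.
  rewrite inE => /pred0Pn[x /andP[/= xF]]; rewrite inE => /eqP px.
  by exists x.
Qed.

Lemma complete n r (T : seq K) (F : 'I_n -> {set V}) :
  1 < r -> n <= r ->
  (forall j, j \in T -> j != k0 /\ exists S, rclique col r j S) ->
  (forall i, clique col k0 (F i)) -> (forall i i', i != i' -> [disjoint F i & F i']) ->
  exists F' : 'I_n -> {set V},
    [/\ forall i, F i \subset F' i, forall i, clique col k0 (F' i),
        forall i i', i != i' -> [disjoint F' i & F' i'] &
        forall i j, j \in T -> exists2 x, x \in F' i & p x = j].
Proof.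
move=> r1 nr + clF disF; elim: T => [_|j T IH TS]; first by exists F; split.
have [|F1 [FF1 clF1 disF1 meetF1]] := IH; first by move=> l lT; apply: TS; rewrite inE lT orbT.
have [jk [S rS]] := TS j (mem_head _ _).
have [F2 [FF2 clF2 disF2 meetF2]] := complete_part r1 nr jk rS clF1 disF1.
exists F2; split=> // [i|i l]; first exact: subset_trans (FF1 i) (FF2 i).
rewrite inE => /orP[/eqP->|lT]; first exact: meetF2.
have [x xF px] := meetF1 i l lT; exists x => //; exact: subsetP (FF2 i) x xF.
Qed.

End Completion.

(** * Ramsey numbers of nK_r *)

Definition pair_color N k (c : coloring N k) (x y : 'I_N) : 'I_k := c [set x; y].

Lemma mem_nK_edges n r i (a b : 'I_r) : a != b -> [set (i, a); (i, b)] \in edges (nK n r).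
Proof.
move=> ab; rewrite inE; apply/existsP; exists (i, a); apply/existsP; exists (i, b).
by rewrite /= /nK_adj /= !eqxx ab.
Qed.

Lemma packing_of_has_mono N k (c : coloring N k) n r :
  0 < n -> 1 < r -> has_mono c (nK n r) ->
  exists a, packing n (rclique (pair_color c) r a).
Proof.
move=> n0 r1 /existsP[f /andP[/injectiveP f_inj /forall_inP mono]].
have edgeE i a b : [set f (i, a); f (i, b)] = f @: [set (i, a); (i, b)].
  by rewrite imsetU1 imset_set1.
pose i0 := Ordinal n0; pose a0 := Ordinal (ltnW r1); pose a1 := Ordinal r1.
exists (c (f @: [set (i0, a0); (i0, a1)])), (fun i => [set f (i, a) | a : 'I_r]).
split=> [i|i j ij].
  apply/andP; split; first by rewrite card_imset ?card_ord // => a b /f_inj[].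
  apply/cliqueP => _ _ /imsetP[a _ ->] /imsetP[b _ ->].
  rewrite (inj_eq f_inj) => ab; rewrite /pair_color edgeE.
  have ab' : a != b by apply: contraNneq ab => ->.
  by have /forall_inP/(_ _ (@mem_nK_edges n r i0 a0 a1 isT))/eqP := mono _ (mem_nK_edges i ab').
rewrite -setI_eq0; apply/eqP/setP => x; rewrite !inE; apply/negP => /andP[].
by case/imsetP=> a _ -> /imsetP[b _ /f_inj[/eqP]]; rewrite (negbTE ij).
Qed.

Lemma has_mono_of_packing N k (c : coloring N k) n r a :
  packing n (rclique (pair_color c) r a) -> has_mono c (nK n r).
Proof.
case=> F [PF disF]; have Fr i : #|F i| = r by case/andP: (PF i) => /eqP.
pose f (u : nK n r) := enum_val (cast_ord (esym (Fr u.1)) u.2).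
have fF u : f u \in F u.1 by exact: enum_valP.
have f_inj : injective f.
  move=> [i x] [j y] fE; have ij : i = j.
    apply/eqP/negPn/negP => /disF/disjoint_setI0/setP/(_ (f (i, x))).
    by rewrite !inE (fF (i, x)) fE (fF (j, y)).
  by subst j; congr pair; apply: cast_ord_inj (enum_val_inj fE).
have fa e : e \in edges (nK n r) -> c ([ffun u => f u] @: e) = a.
  rewrite inE => /existsP[u /existsP[v /andP[uv /eqP->]]].
  rewrite imsetU1 imset_set1 !ffunE; case/andP: (PF u.1) => _ /cliqueP; apply=> //.
    by case/andP: uv => /eqP-> _; exact: fF.
  by rewrite (inj_eq f_inj); apply: contraTneq uv => ->; rewrite adj_irr.
apply/existsP; exists [ffun u => f u]; apply/andP; split.
  by apply/injectiveP => u v; rewrite !ffunE; exact: f_inj.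
by apply/forall_inP => e eH; apply/forall_inP => e' eH'; rewrite !fa.
Qed.

Lemma no_rainbow_P5_of_coloring N k (c : coloring N k) :
  ~~ has_rainbow c (path_graph 5) -> no_rainbow_P5 (pair_color c).
Proof.
move=> /negP rb q szq Uq; apply/negP => Uc; apply: rb.
case: q szq Uq Uc => // x0 q' /= [szq'] Uq Uc.
pose q := x0 :: q'; pose f (i : path_graph 5) := nth x0 q i.
have szc : size (pairmap (pair_color c) x0 q') = 4 by rewrite size_pairmap.
have f_inj : injective f.
  by move=> i j /eqP; rewrite nth_uniq //= ?szq' // => /eqP/val_inj.
have eE e : e \in edges (path_graph 5) ->
    exists i : nat, [/\ i < 4, e = [set inord i; inord i.+1] &
      c ([ffun i => f i] @: e) = nth (c set0) (pairmap (pair_color c) x0 q') i].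
  rewrite inE => /existsP[x /existsP[y /andP[xy /eqP->]]].
  wlog xy1 : x y xy / x.+1 = y :> nat.
    move=> wl; case/orP: (xy) => /eqP xyE; first exact: wl.
    by rewrite setUC; apply: wl => //; rewrite adj_sym.
  have x4 : x < 4 by rewrite -ltnS xy1 ltn_ord.
  exists x; split=> //; first by rewrite xy1 !inord_val.
  rewrite (nth_pairmap x0) ?szq' // imsetU1 imset_set1 !ffunE /pair_color.
  by rewrite /f -xy1.
apply/existsP; exists [ffun i => f i]; apply/andP; split.
  by apply/injectiveP => i j; rewrite !ffunE; exact: f_inj.
apply/forall_inP => e /eE[i [i4 eI ->]]; apply/forall_inP => e' /eE[j [j4 eJ ->]].
apply/implyP => ee'; rewrite nth_uniq ?szc //; apply: contraNneq ee' => ij.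
by rewrite eI eJ ij.
Qed.

(** Transfers the Ramsey property from set-indexed colorings of ['I_N] to symmetric color functions
    on any large enough finite type. *)
Lemma ramsey_packing n r (X K : finType) (d : X -> X -> K) :
  0 < n -> 1 < r -> #|K| <= 3 -> (forall x y, d x y = d y x) ->
  ramsey 3 (nK n r) <= #|X| -> exists a, packing n (rclique d r a).
Proof.
move=> n0 r1 K3 d_sym; rewrite /ramsey; case: ex_minnP => N /forallP HN _ NX.
pose g (i : 'I_N) : X := enum_val (widen_ord NX i).
have g_inj : injective g by move=> i j /enum_val_inj/(congr1 val)/= /val_inj.
pose rk (a : K) : 'I_3 := widen_ord K3 (enum_rank a).
have rk_inj : injective rk by move=> a b /(congr1 val)/= /val_inj/enum_rank_inj.
pose c : coloring N 3 := [ffun S : {set 'I_N} =>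
  if [pick q : 'I_N * 'I_N | S == [set q.1; q.2]] is Some q then rk (d (g q.1) (g q.2)) else ord0].
have cE x y : x != y -> pair_color c x y = rk (d (g x) (g y)).
  move=> xy; rewrite /pair_color ffunE.
  case: pickP => [[u v] /= /eqP E|/(_ (x, y))]; last by rewrite eqxx.
  have := set21 x y; have := set22 x y; rewrite E !inE.
  case/orP=> /eqP yE /orP[]/eqP xE; subst; rewrite ?eqxx // in xy *.
  by rewrite d_sym.
have [a [F [PF disF]]] := packing_of_has_mono n0 r1 (HN c).
(* The common color in ['I_3] is that of some edge, since [n > 0] and [r > 1]; hence it comes from a
   color in [K], unique as [rk] is injective. *)
have [b bE] : exists b, forall i, clique d b (g @: F i).
  have [x [y [xF yF xy]]] : exists x y, [/\ x \in F (Ordinal n0), y \in F (Ordinal n0) & x != y].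
    by apply/card_gt1P; case/andP: (PF (Ordinal n0)) => /eqP->.
  have aE : rk (d (g x) (g y)) = a.
    by rewrite -cE //; case/andP: (PF (Ordinal n0)) => _ /cliqueP; apply.
  exists (d (g x) (g y)) => i; apply/cliqueP => _ _ /imsetP[u uF ->] /imsetP[v vF ->].
  rewrite (inj_eq g_inj) => uv; apply: rk_inj; rewrite aE -cE //.
  by case/andP: (PF i) => _ /cliqueP; apply.
exists b, (fun i => g @: F i); split=> [i|i j ij].
  by rewrite /rclique bE card_imset // andbT; case/andP: (PF i).
rewrite imset_disjoint; [exact: disF|exact: g_inj].
Qed.

Lemma card_imset_geq (X Y : finType) (g : X -> Y) (S : {set X}) (T : {set Y}) :
  (forall y, y \in T -> exists2 x, x \in S & g x = y) -> #|T| <= #|S|.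
Proof.
move=> onto; apply: leq_trans (leq_imset_card g S); apply: subset_leq_card.
by apply/subsetP => y /onto[x xS <-]; exact: imset_f.
Qed.

(* Every vertex of [W] becomes a clique of size r - 1 in a third color, one of these
   cliques is enlarged by (n - 1)r vertices, and n - 1 further vertices are joined to
   everything by one of the colors of [d]. *)
Lemma ramsey_nK_lower_bound n r (W : finType) (d : rel W) (w0 : W) :
  0 < n -> 1 < r -> symmetric d -> (forall b S, ~~ rclique d r b S) ->
  r.-1 * #|W| + n.-1 * r + n.-1 < ramsey 3 (nK n r).
Proof.
move=> n0 r1 d_sym no_clique; rewrite ltnNge; apply/negP => le_R.
pose X : finType := ((W * 'I_r.-1 + 'I_(n.-1 * r)) + 'I_n.-1)%type.
pose proj (x : X) : option W :=
  match x with inl (inl (w, _)) => Some w | inl (inr _) => Some w0 | inr _ => None end.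
pose col (x y : X) : option bool :=
  match proj x, proj y with
  | Some u, Some v => if u == v then None else Some (d u v)
  | _, _ => Some true
  end.
have col_sym x y : col x y = col y x.
  by rewrite /col; case: (proj x) (proj y) => [u|] [v|] //; rewrite eq_sym d_sym.
have [||a [F [PF disF]]] := ramsey_packing n0 r1 _ col_sym (K := _) (X := X).
- by rewrite card_option card_bool.
- by rewrite !card_sum card_prod !card_ord mulnC.
have Fr i : #|F i| = r by case/andP: (PF i) => /eqP.
have clF i : clique col a (F i) by case/andP: (PF i).
have projF i : a != Some true -> forall x, x \in F i -> proj x != None.
  move=> aT x xF; apply: contra_neq aT => px.
  have [y yF] : exists y, y \in F i :\ x.
    by apply/card_gt0P; have := cardsD1 x (F i); rewrite xF Fr; lia.
  move: yF; rewrite !inE eq_sym => /andP[xy yF].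
  by have /cliqueP/(_ x y xF yF xy) := clF i; rewrite /col px.
have no_b b i : a = Some b -> ~ forall x, x \in F i -> proj x != None.
  move=> ab pF; pose g x := odflt w0 (proj x).
  have colE x y : x \in F i -> y \in F i -> x != y -> (g x != g y) /\ d (g x) (g y) = b.
    move=> xF yF xy; have /cliqueP/(_ x y xF yF xy) := clF i.
    move: (pF x xF) (pF y yF); rewrite /col /g ab.
    by case: (proj x) (proj y) => [u|] [v|] //= _ _; case: eqP => //= _ [].
  have g_inj : {in F i &, injective g}.
    move=> x y xF yF gxy; apply/eqP/negPn/negP => /(colE _ _ xF yF)[].
    by rewrite gxy eqxx.
  case/negP: (no_clique b (g @: F i)); rewrite /rclique card_in_imset // Fr eqxx.
  apply/cliqueP => _ _ /imsetP[x xF ->] /imsetP[y yF ->] gxy.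
  by have [] := colE x y xF yF _; first by apply: contraNneq gxy => ->.
case: a => [[]|] in PF clF projF no_b *.
(* By [no_b], every clique in color [Some true] uses one of the [n - 1] joined vertices, too few for
   [n] disjoint cliques. *)
- have /fin_all_exists[h hF] i : exists j : 'I_n.-1, inr j \in F i.
    apply/existsP; apply: contraT => noj; case: (no_b true i erefl) => [[x|j] xF] //.
      by case: x xF => [[]|].
    by case/negP: noj; apply/existsP; exists j.
  have h_inj : injective h.
    move=> i j hij; apply/eqP/negPn/negP => /disF/disjoint_setI0/setP/(_ (inr (h i))).
    by rewrite !inE hF hij hF.
  by have := leq_card h h_inj; rewrite !card_ord; lia.
- by have := no_b false (Ordinal n0) erefl; apply; exact: projF.
have one_proj i x y : x \in F i -> y \in F i -> proj x = proj y.
  move=> xF yF; have [-> //|xy] := eqVneq x y.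
  have /cliqueP/(_ x y xF yF xy) := clF i.
  move: (projF i isT x xF) (projF i isT y yF); rewrite /col.
  by case: (proj x) (proj y) => [u|] [v|] //= _ _; case: eqP => [->|].
(* In the third color each clique lies in one block. Blocks other than that of [w0] have [r - 1]
   vertices, and that of [w0] has [(r - 1) + (n - 1)r = nr - 1]. *)
have proj0 i x : x \in F i -> proj x = Some w0.
  move=> xF; apply/eqP/negPn/negP => px.
  have [w pw] : exists w, proj x = Some w.
    by have := projF i isT x xF; case: (proj x) => [w|] // _; exists w.
  have sub : F i \subset [set inl (inl (w, k)) | k : 'I_r.-1].
    apply/subsetP => y yF; have := one_proj i x y xF yF; rewrite pw.
    case: y yF => [[[u k]|k]|k] yF //=; first by move=> [<-]; exact: imset_f.
    by move=> [ww]; case/eqP: px; rewrite pw ww.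
  have := leq_trans (subset_leq_card sub) (leq_imset_card _ _).
  by rewrite Fr card_ord; lia.
pose h (z : 'I_r.-1 + 'I_(n.-1 * r)) : X :=
  match z with inl k => inl (inl (w0, k)) | inr k => inl (inr k) end.
have sub : \bigcup_i F i \subset h @: setT.
  apply/subsetP => x /bigcupP[i _ xF]; have := proj0 i x xF.
  case: x xF => [[[u k]|k]|k] xF //=; last by move=> _; apply/imsetP; exists (inr k).
  by move=> [->]; apply/imsetP; exists (inl k).
have := leq_trans (subset_leq_card sub) (leq_imset_card _ _).
rewrite cardsT card_sum !card_ord -sum1_card partition_disjoint_bigcup //.
under eq_bigr => i _ do rewrite sum1_card Fr.
by rewrite sum_nat_const card_ord; nia.
Qed.

(** Here [d] is a disjoint union of [r - 1] copies of [K_(r-1)]: one of the two projections to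
    [r - 1] elements is injective on a monochromatic clique. *)
Lemma ramsey_nK_lower_bound3 n r : 0 < n -> 1 < r ->
  r.-1 * (r.-1 * r.-1) + n.-1 * r + n.-1 < ramsey 3 (nK n r).
Proof.
move=> n0 r1; have r0 : 0 < r.-1 by lia.
have := @ramsey_nK_lower_bound n r ('I_r.-1 * 'I_r.-1)%type (fun x y => x.1 == y.1)
  (Ordinal r0, Ordinal r0) n0 r1.
rewrite card_prod !card_ord; apply=> [x y|b S]; first by rewrite eq_sym.
apply/negP => /andP[/eqP Sr /cliqueP clS].
have [g g_inj] : exists g : 'I_r.-1 * 'I_r.-1 -> 'I_r.-1, {in S &, injective g}.
  case: b clS => clS; [exists snd|exists fst] => x y xS yS gxy.
    have [//|xy] := eqVneq x y; have /eqP E := clS x y xS yS xy.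
    by rewrite [x]surjective_pairing [y]surjective_pairing E gxy.
  by apply/eqP/negPn/negP => /(clS x y xS yS); rewrite gxy eqxx.
have := max_card (g @: S); rewrite card_in_imset // Sr card_ord; lia.
Qed.

(** * Colorings with a dominant color *)

Section Dominant.
Variables (V K : finType) (col : V -> V -> K) (k0 : K) (p : V -> K) (n r : nat).
Hypothesis col_sym : forall x y, col x y = col y x.
Hypothesis dom : forall x y, x != y -> col x y != k0 -> p x = col x y /\ p y = col x y.
Hypotheses (n2 : 1 < n) (nr : n < r).
Hypothesis no_packing : forall a, ~ packing n (rclique col r a).

Definition clique_colors : {set K} :=
  [set j | (j != k0) && [exists S, rclique col r j S]].
Local Notation T := clique_colors.

Let n0 : 0 < n := ltnW n2.
Let r1 : 1 < r := ltn_trans n2 nr.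

Lemma complete_colors (F : 'I_n -> {set V}) :
  (forall i, clique col k0 (F i)) -> (forall i i', i != i' -> [disjoint F i & F i']) ->
  exists F' : 'I_n -> {set V},
    [/\ forall i, F i \subset F' i, forall i, clique col k0 (F' i),
        forall i i', i != i' -> [disjoint F' i & F' i'] &
        forall i j, j \in T -> exists2 x, x \in F' i & p x = j].
Proof.
move=> clF disF.
have [|F' [FF' clF' disF' meetF']] := complete col_sym dom r1 (ltnW nr) (T := enum T) _ clF disF.
  by move=> j; rewrite mem_enum inE => /andP[jk /existsP].
by exists F'; split=> // i j jT; apply: meetF'; rewrite mem_enum.
Qed.

(** Completing [n] empty sets gives disjoint [k0]-cliques meeting every part of [T]; with [r] parts
    each would contain a [K_r]. *)
Lemma few_clique_colors : #|T| < r.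
Proof.
rewrite ltnNge; apply/negP => rT.
have [||F [_ clF disF meetF]] := @complete_colors (fun=> set0).
- by move=> i; apply/cliqueP => x y; rewrite inE.
- by move=> i i' _; rewrite -setI_eq0 set0I.
case: (no_packing (packing_of_geq (r := r) _ clF disF)) => i.
by apply: leq_trans rT (card_imset_geq (g := p) _) => j; exact: meetF.
Qed.

Lemma part_bound j (B : {set V}) :
  (forall x y, x != y -> p x = p y -> x \notin B -> y \notin B -> col x y != k0) ->
  #|[set x | p x == j] :\: B| <= n * r - 1.
Proof.
move=> noB; rewrite leqNgt; apply/negP => big.
apply: (no_packing (packing_in_clique (a := j) n0 (S := [set x | p x == j] :\: B) _ _)).
  by rewrite -(@subnK 1 (n * r)) ?addn1 // muln_gt0 n0 ltnW.
apply/cliqueP => x y; rewrite !inE => /andP[xB /eqP px] /andP[yB /eqP py] xy.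
by have [<-] := dom xy (noB x y xy (etrans px (esym py)) xB yB).
Qed.

(* A vertex outside the parts of [T], or an edge of color [k0] inside a part, extends,
   through one vertex of each part of [T] that it misses, to a clique of size r; so
   no n of these can be disjoint. *)
Lemma max_clique_colors_bound : #|T| = r.-1 -> #|V| <= n.-1 * 2 + r.-1 * (n * r - 1).
Proof.
move=> Tr.
pose P (S : {set V}) := [exists z, (S == [set z]) && (p z \notin T)] ||
  [exists x, exists y, [&& x != y, p x == p y, col x y == k0 & S == [set x; y]]].
have [S||[B cB hitB]] := @packing_or_hitting V P n 2.
- case/orP=> [/existsP[z /andP[/eqP-> _]]|]; first by rewrite cards1.
  by case/existsP=> x /existsP[y /and4P[_ _ _ /eqP->]]; rewrite cards2; case: (x != y).
- case=> F [PF disF]; have clF i : clique col k0 (F i).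
    apply/cliqueP => x y; case/orP: (PF i).
      by case/existsP=> z /andP[/eqP-> _] /set1P-> /set1P->; rewrite eqxx.
    case/existsP=> u /existsP[v /and4P[uv _ /eqP cuv /eqP->]].
    by case/set2P=> -> /set2P[]->; rewrite ?eqxx // col_sym.
  have [F' [FF' clF' disF' meetF']] := complete_colors clF disF.
  case: (no_packing (packing_of_geq (r := r) _ clF' disF')) => i.
  have -> : r = #|T|.+1 by rewrite Tr; lia.
  case/orP: (PF i) => [/existsP[z /andP[/eqP Fz pzT]]|].
    have := @card_imset_geq _ _ p (F' i) (p z |: T); rewrite cardsU1 pzT; apply=> j.
    case/setU1P=> [->|]; last exact: meetF'.
    by exists z => //; apply: (subsetP (FF' i)); rewrite Fz set11.
  case/existsP=> x /existsP[y /and4P[xy /eqP pxy _ /eqP Fxy]].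
  have xF : x \in F' i by apply: (subsetP (FF' i)); rewrite Fxy set21.
  have yF : y \in F' i by apply: (subsetP (FF' i)); rewrite Fxy set22.
  rewrite (cardsD1 x (F' i)) xF add1n ltnS.
  (* Dropping [x] loses no part, because [y] lies in the same one; the remaining vertices still meet
     all [r - 1] parts. *)
  apply: (card_imset_geq (g := p)) => j /(meetF' i)[u uF pu].
  have [ux|ux] := eqVneq u x; last by exists u => //; rewrite !inE ux.
  by exists y; rewrite ?inE 1?eq_sym ?xy // -pxy -ux.
have outB x : x \notin B -> p x \in T.
  move=> xB; apply: contraR xB => pxT; have := hitB [set x]; rewrite disjoints1 negbK.
  by apply; apply/orP; left; apply/existsP; exists x; rewrite eqxx.
have sub : ~: B \subset \bigcup_(j in T) ([set x | p x == j] :\: B).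
  apply/subsetP => x; rewrite inE => xB; apply/bigcupP; exists (p x); first exact: outB.
  by rewrite !inE xB eqxx.
rewrite -(cardsC B); apply: leq_add cB (leq_trans (subset_leq_card sub) _).
rewrite -Tr; apply: leq_card_bigcup => j _; apply: part_bound => x y xy pxy xB yB.
apply/negP => cxy; have := hitB [set x; y]; rewrite -setI_eq0 => /(_ _)/negP[].
  by apply/orP; right; apply/existsP; exists x; apply/existsP; exists y; rewrite xy pxy cxy !eqxx.
apply/eqP/setP => z; rewrite !inE; apply/negP => /andP[/orP[]/eqP->]; exact/negP.
Qed.

(** Deleting hitting sets for [k0] and for the colors in [T] suffices: a clique avoiding [k0] lies
    in a single part, so it is monochromatic and its color belongs to [T]. *)
Lemma clique_free_subset :
  exists2 A : {set V}, #|V| <= #|A| + #|T|.+1 * (n.-1 * r) &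
    forall b (S : {set {x | x \in A}}), ~~ rclique (fun x y => col (val x) (val y) == k0) r b S.
Proof.
have /fin_all_exists2[B cB hitB] a := rclique_hitting (@no_packing a).
pose U := \bigcup_(a in k0 |: T) B a; exists (~: U).
  rewrite -(cardsC U) addnC leq_add2l.
  have <- : #|k0 |: T| = #|T|.+1 by rewrite cardsU1 inE eqxx.
  by apply: leq_card_bigcup.
have BU a (S : {set {x | x \in ~: U}}) : a \in k0 |: T -> ~~ rclique col r a (val @: S).
  move=> aT; apply/negP => /hitB/negP[]; rewrite -setI_eq0; apply/eqP/setP => y.
  rewrite !inE; apply/negP => /andP[/imsetP[x _ ->] xB].
  by have := valP x; rewrite inE => /negP[]; apply/bigcupP; exists a.
move=> b S; apply/negP => /andP[/eqP Sr /cliqueP clS].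
have val_r : #|val @: S| = r by rewrite card_imset //; exact: val_inj.
case: b clS => clS.
  case/negP: (BU k0 S (setU11 _ _)); rewrite /rclique val_r eqxx.
  apply/cliqueP => _ _ /imsetP[x xS ->] /imsetP[y yS ->] xy.
  by apply/eqP; apply: clS => //; apply: contraNneq xy => ->.
have [x [y [xS yS xy]]] : exists x y, [/\ x \in S, y \in S & x != y].
  by apply/card_gt1P; rewrite Sr.
have domS u v : u \in S -> v \in S -> u != v ->
    p (val u) = col (val u) (val v) /\ p (val v) = col (val u) (val v).
  by move=> uS vS uv; apply: dom; rewrite ?(inj_eq val_inj) // clS.
have pS u : u \in S -> p (val u) = p (val x).
  move=> uS; have [-> //|ux] := eqVneq u x; by have [-> ->] := domS u x uS xS ux.
have rS : rclique col r (p (val x)) (val @: S).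
  rewrite /rclique val_r eqxx; apply/cliqueP => _ _ /imsetP[u uS ->] /imsetP[v vS ->].
  by rewrite (inj_eq val_inj) => uv; have [<- _] := domS u v uS vS uv; exact: pS.
suff jT : p (val x) \in k0 |: T by have := BU _ S jT; rewrite rS.
rewrite !inE; apply/orP; right.
apply/andP; split; last by apply/existsP; exists (val @: S).
by have [-> _] := domS x y xS yS xy; rewrite clS.
Qed.

Lemma dominant_lt_ramsey : #|V| < ramsey 3 (nK n r).
Proof.
have LB := ramsey_nK_lower_bound3 n0 r1; have Tr := few_clique_colors.
rewrite ltnNge; apply/negP => RV; have {}LB := leq_trans LB RV.
have [Tr1|Tr1] := eqVneq #|T| r.-1.
  have := leq_trans LB (max_clique_colors_bound Tr1); apply/negP; rewrite -leqNgt.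
  have -> : n * r - 1 = n.-1 * r.-1 + n.-1 + r.-1 by nia.
  (* With [m = n - 1] and [s = r - 1] the two bounds reduce to [s^3 < (m + 1)s^2], against
     [m < s]. *)
  have : n.-1 < r.-1 by lia.
  move: (n.-1) (r.-1) (prednK (ltnW r1)) => m s <- ms; nia.
have [A cA freeA] := clique_free_subset.
have cTA : #|T|.+1 * (n.-1 * r) <= r.-1 * (n.-1 * r) by rewrite leq_mul2r; lia.
have {}cA : #|V| <= #|A| + r.-1 * (n.-1 * r) by apply: leq_trans cA _; rewrite leq_add2l.
have LBA : #|A| = 0 \/ r.-1 * #|A| + n.-1 * r + n.-1 < #|V|.
  have [A0|/card_gt0P[w wA]] := posnP #|A|; [by left|right].
  apply: leq_trans RV; rewrite -[X in _ * X]card_sig.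
  by apply: (ramsey_nK_lower_bound (Sub w wA) n0 r1 _ freeA) => x y; rewrite col_sym.
have : n.-1 < r.-1 by lia.
move: #|A| #|V| (n.-1) (r.-1) (prednK (ltnW r1)) LB cA LBA => a v m s <- LB cA LBA ms.
case: LBA => [a0|LBA]; first by subst a; nia.
(* Comparing the bounds in [a] gives [(s - 1)a < (s - 1)m(s + 1)]. Then [v < m(s + 1)^2], which
   contradicts the cubic lower bound because [m <= s - 1]. *)
have am : a < m * s.+1 by nia.
nia.
Qed.
End Dominant.

Theorem theorem4p11 (r n : nat) (hr : 3 <= r) (hn2 : 2 <= n) (hnr : n <= r - 1) :
  ~ in_scriptH (nK n r).
Proof.
case=> _ [k [_]]; rewrite /gallai_ramsey; case: ex_minnP => N _ minN.
(* By minimality of [N], it suffices to treat colorings of the complete graph on [ramsey 3 (nK n r)]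
   vertices. *)
rewrite ltnNge => /negP; apply; apply: minN; apply/forallP => c.
have n0 : 0 < n by lia.
have r1 : 1 < r by lia.
apply/norP => -[/no_rainbow_P5_of_coloring rb mono].
set col := pair_color c in rb.
have col_sym x y : col x y = col y x by rewrite /col /pair_color setUC.
have no_packing a : ~ packing n (rclique col r a).
  by move=> pk; move: mono; rewrite (has_mono_of_packing pk).
have LB := ramsey_nK_lower_bound3 n0 r1.
(* This leaves [nr] vertices after deleting six, and also provides the six vertices that the
   structure lemma requires. *)
have R6 : n * r + 6 <= ramsey 3 (nK n r).
  apply: leq_trans LB; have : 0 < n.-1 < r.-1 by lia.
  move: (n.-1) (r.-1) (prednK n0) (prednK (ltnW r1)) => m s <- <- ms.
  have s4 : 4 * s <= s * (s * s) by nia.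
  lia.
have [|[l l3 col_l]|[k0 [p dom]]|[Q [a [cQ colQ]]]] := no_rainbow_structure col_sym rb.
- by rewrite card_ord; lia.
(* Colors are recoded by their positions in [l], and [nth] recovers them. *)
- pose d x y : 'I_3 := inord (index (col x y) l).
  have [|x y||a [F [PF disF]]] := @ramsey_packing n r _ _ d n0 r1.
  + by rewrite card_ord.
  + by rewrite /d col_sym.
  + by rewrite card_ord.
  case: (no_packing (nth (c set0) l a)); exists F; split=> // i.
  case/andP: (PF i) => Fr /cliqueP clF; rewrite /rclique Fr; apply/cliqueP => x y xF yF xy.
  rewrite -(clF x y xF yF xy) inordK ?nth_index ?col_l //.
  by apply: leq_trans l3; rewrite index_mem col_l.
- have hnr' : n < r by lia.
  by have := dominant_lt_ramsey col_sym dom hn2 hnr' no_packing; rewrite card_ord ltnn.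
- apply: (no_packing a); apply: (packing_in_clique (S := ~: Q) n0).
    by have := cardsC Q; rewrite card_ord; lia.
  by apply/cliqueP => x y; rewrite !inE; exact: colQ.
Qed.
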